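(* Let $\Pi$ be a finite projective plane of order $q\geq 23$. Then the metric dimension of the incidence graph of $\Pi$ is $4q-4$.
   Context: The incidence graph of a projective plane $\Pi=(\mathcal{P},\mathcal{L})$ is the bipartite graph with vertex classes $\mathcal{P}$ (points) and $\mathcal{L}$ (lines), a point and a line being adjacent iff they are incident. For a connected graph $\Gamma=(V,E)$ with distance $d$, a set $S=\{s_1,\dots,s_k\}\subseteq V$ is a resolving set if the ordered distance lists $(d(x,s_1),\dots,d(x,s_k))$ are pairwise distinct for distinct $x\in V$. The metric dimension of $\Gamma$ is the size of a smallest resolving set. *)

(* Defs.v *)
From mathcomp Require Import all_boot.

Set Implicit Arguments.
Unset Strict Implicit.
Unset Printing Implicit Defensive.

Record projective_plane (P L : finType) (inc : P -> L -> bool) : Prop := {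
  pp_join : forall p1 p2 : P, p1 != p2 -> exists! l : L, inc p1 l /\ inc p2 l;
  pp_meet : forall l1 l2 : L, l1 != l2 -> exists! p : P, inc p l1 /\ inc p l2;
  pp_quadrangle : exists Q : {set P},
    #|Q| = 4 /\ forall l : L, #|[set p in Q | inc p l]| <= 2 }.

Definition plane_order (P L : finType) (inc : P -> L -> bool) (q : nat) : Prop :=
  forall l : L, #|[set p | inc p l]| = q.+1.

Definition incidence_graph (P L : finType) (inc : P -> L -> bool) :
    rel (P + L)%type :=
  fun u v =>
    match u, v with
    | inl p, inr l => inc p l
    | inr l, inl p => inc p l
    | _, _ => false
    end.

Section MetricDimension.

Variables (V : finType) (e : rel V).

Definition has_walk (x y : V) (n : nat) : bool :=
  [exists w : n.-tuple V, path e x w && (last x w == y)].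

(* A shortest walk has length < #|V|, so the search bound is harmless; the     *)
(* value is #|V| when y is not reachable from x.                               *)
Definition gdist (x y : V) : nat := find (has_walk x y) (iota 0 #|V|).

Definition dist_list (S : {set V}) (x : V) : seq nat :=
  [seq gdist x s | s <- enum S].

Definition resolving_set (S : {set V}) : bool := injectiveb (dist_list S).

(* [set: V] is only the default of the minimisation; it is always resolving,   *)
(* see resolving_setT.                                                         *)
Definition metric_dimension : nat :=
  #|[arg min_(S < [set: V] | resolving_set S) #|S|]|.

Lemma gdistP x y : connect e x y ->
  has_walk x y (gdist x y) /\ forall n, has_walk x y n -> gdist x y <= n.
Proof.
case/connectP=> p0 ep0 ->; case/shortenP: ep0 => p ep Up _.
set y' := last x p.
have sp : size p < #|V| by have := max_card (mem (x :: p)); rewrite (card_uniqP Up).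
have wp : has_walk x y' (size p).
  by apply/existsP; exists (in_tuple p); rewrite ep eqxx.
have hs : has (has_walk x y') (iota 0 #|V|).
  by apply/hasP; exists (size p); rewrite ?mem_iota.
have lt : gdist x y' < #|V| by rewrite /gdist -{2}(size_iota 0 #|V|) -has_find.
split; first by have := nth_find 0 hs; rewrite nth_iota.
move=> n wn; rewrite leqNgt; apply/negP=> ln.
have := before_find 0 ln; rewrite nth_iota ?add0n ?wn //.
exact: ltn_trans ln lt.
Qed.

Lemma gdist_eq0 x y : (gdist x y == 0) = (x == y).
Proof.
apply/eqP/eqP=> [d0 | <-].
  have V0 : 0 < #|V| by apply/card_gt0P; exists x.
  have hs : has (has_walk x y) (iota 0 #|V|).
    by rewrite has_find -/(gdist x y) d0 size_iota.
  have := nth_find 0 hs; rewrite -/(gdist x y) d0 nth_iota //.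
  by case/existsP=> w; rewrite (tuple0 w) /= => /eqP.
have [_ /(_ 0)] := gdistP (connect0 e x); rewrite leqn0 => h.
by apply/eqP/h/existsP; exists [tuple]; rewrite /= eqxx.
Qed.

Lemma resolving_setT : resolving_set [set: V].
Proof.
apply/injectiveP=> x y /eq_in_map /(_ x).
rewrite mem_enum in_setT => /(_ isT) /esym /eqP.
have /eqP -> : gdist x x == 0 by rewrite gdist_eq0.
by rewrite gdist_eq0 => /eqP.
Qed.

Lemma metric_dimensionP :
  (exists2 S : {set V}, resolving_set S & #|S| = metric_dimension) /\
  forall S : {set V}, resolving_set S -> metric_dimension <= #|S|.
Proof.
rewrite /metric_dimension; case: arg_minnP; first exact: resolving_setT.
by move=> S rS minS; split=> //; exists S.
Qed.

End MetricDimension.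

(* Main.v *)
Require Import Defs.
From mathcomp Require Import all_boot.
From mathcomp Require Import zify.

(**
A set S, with points A and lines B, is resolving iff at most one line outside B
misses A, every point of A is on at most one tangent of A outside B, and dually.

Suppose |A| + |B| <= 4q - 5; by duality |A| <= 2q - 3.  Counting incidences gives
|A| >= 2q - 5.  Counting over the lines that meet a fixed line outside A shows that
every line has at most 3 or at least q - 4 points of A, and then the second moment
of the intersection numbers forces two lines e, f with at least q - 4 points.  Put
O = e /\ f.  Apart from few exceptions, the lines through O, and those joining a
missing point of e to f or a missing point of f to e, are skew or tangent to A, so
they have to be in B, and this makes B too large.

For the upper bound, let A consist of e minus {O, r} and f minus {O, b}, where r is
on e and b on f, and let B consist of the lines through O except e, f and the lines
through r except e, n, where n is another line through r.
*)

Set Implicit Arguments.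
Unset Strict Implicit.
Unset Printing Implicit Defensive.

(** * Projective planes in self-dual form *)

(** The fields are self-dual or come in dual pairs, so every result about point sets also holds for
    line sets. [rp_join] and [rp_meet] allow equal arguments, which makes [join] and [meet] below
    total. *)
Record regular_plane (P L : finType) (inc : P -> L -> bool) (q : nat) : Prop := {
  rp_uniq : forall p1 p2 l1 l2, p1 != p2 ->
    inc p1 l1 -> inc p2 l1 -> inc p1 l2 -> inc p2 l2 -> l1 = l2;
  rp_join : forall p1 p2, exists l, inc p1 l && inc p2 l;
  rp_meet : forall l1 l2, exists p, inc p l1 && inc p l2;
  rp_line : forall l, #|[set p | inc p l]| = q.+1;
  rp_pencil : forall p, #|[set l | inc p l]| = q.+1 }.

Definition dual (P L : finType) (inc : P -> L -> bool) (l : L) (p : P) : bool :=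
  inc p l.

Lemma regular_plane_dual (P L : finType) (inc : P -> L -> bool) q :
  regular_plane inc q -> regular_plane (dual inc) q.
Proof.
case=> u j m ls ps; split=> //.
by move=> l1 l2 p1 p2 nl a b c d; apply: contraNeq nl => np; apply/eqP/(u p1 p2).
Qed.

Section Regular.

Variables (P L : finType) (inc : P -> L -> bool) (q : nat).
Hypothesis plane : projective_plane inc.
Hypothesis order_q : plane_order inc q.

Lemma plane_uniq p1 p2 l1 l2 : p1 != p2 ->
  inc p1 l1 -> inc p2 l1 -> inc p1 l2 -> inc p2 l2 -> l1 = l2.
Proof.
move=> np a b c d; have [l [_ U]] := pp_join plane np.
by rewrite -(U l1) ?(U l2).
Qed.

(** If all lines passed through [p], the line from any point to a fixed [r] would be the line [pr];
    all points would be collinear, against the quadrangle. *)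
Lemma exists_line_avoiding p : exists l, ~~ inc p l.
Proof.
have [Q [Q4 Q2]] := pp_quadrangle plane.
apply/existsP; apply: contraT; rewrite negb_exists => /forallP h.
have hp l : inc p l by move: (h l); rewrite negbK.
have [r rQ rp] : exists2 r, r \in Q & r != p.
  have: 0 < #|Q :\ p| by have := cardsD1 p Q; rewrite Q4; case: (p \in Q); lia.
  by case/card_gt0P=> r; rewrite !inE => /andP[? ?]; exists r.
have [l [[lr lp] _]] := pp_join plane rp.
have Ql s : inc s l.
  have [->//|sp] := eqVneq s p; have [->//|sr] := eqVneq s r.
  have [m [[ms mr] _]] := pp_join plane sr.
  by rewrite (plane_uniq rp lr (hp l) mr (hp m)).
have := Q2 l; suff -> : [set s in Q | inc s l] = Q by rewrite Q4.
by apply/setP=> s; rewrite !inE Ql andbT.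
Qed.

(** Projection from [p] onto a line [m] off [p] matches the lines through [p] with the points of
    [m]. *)
Lemma regular_plane_of_order : regular_plane inc q.
Proof.
have pencil p : #|[set l | inc p l]| = q.+1.
  have [m pm] := exists_line_avoiding p.
  rewrite -(order_q m).
  have hm l : l \in [set l | inc p l] -> exists r, inc r l && inc r m.
    rewrite inE => pl; have nl : l != m by apply: contraTneq pl => ->.
    by have [r [[a b] _]] := pp_meet plane nl; exists r; rewrite a b.
  have hj r : r \in [set r | inc r m] -> exists l, inc r l && inc p l.
    rewrite inE => rm; have rp : r != p by apply: contraTneq rm => ->.
    by have [l [[a b] _]] := pp_join plane rp; exists l; rewrite a b.
  apply/eqP; rewrite eqn_leq; apply/andP; split.
    (* The default is never taken for [l] through [p], since [l] and [m] meet. *)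
    pose F l := odflt p [pick r | inc r l && inc r m].
    have FP l : l \in [set l | inc p l] -> inc (F l) l && inc (F l) m.
      by rewrite /F => /hm[r hr]; case: pickP => [//|/(_ r)]; rewrite hr.
    rewrite -(@card_in_imset _ _ F).
      apply/subset_leq_card/subsetP=> r /imsetP[l /FP/andP[_ h] ->].
      by rewrite inE.
    move=> l1 l2 h1 h2 eF; have /andP[a b] := FP _ h1; have /andP[c d] := FP _ h2.
    have np : F l1 != p by apply: contraTneq b => ->.
    rewrite !inE in h1 h2.
    by apply: (plane_uniq np) => //; rewrite eF.
  pose G r := odflt m [pick l | inc r l && inc p l].
  have GP r : r \in [set r | inc r m] -> inc r (G r) && inc p (G r).
    by rewrite /G => /hj[l hl]; case: pickP => [//|/(_ l)]; rewrite hl.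
  rewrite -(@card_in_imset _ _ G).
    apply/subset_leq_card/subsetP=> l /imsetP[r /GP/andP[_ h] ->].
    by rewrite inE.
  move=> r1 r2 h1 h2 eG; have /andP[a b] := GP _ h1; have /andP[c d] := GP _ h2.
  rewrite !inE in h1 h2; apply/eqP; apply: contraNT pm => nr.
  by rewrite -(plane_uniq nr a _ h1 h2) // eG.
split=> //; first exact: plane_uniq.
- move=> p1 p2; have [->|np] := eqVneq p1 p2.
    have /card_gt0P[l] : 0 < #|[set l | inc p2 l]| by rewrite pencil.
    by rewrite inE => h; exists l; rewrite h.
  by have [l [[a b] _]] := pp_join plane np; exists l; rewrite a b.
- move=> l1 l2; have [->|nl] := eqVneq l1 l2.
    have /card_gt0P[p] : 0 < #|[set p | inc p l2]| by rewrite order_q.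
    by rewrite inE => h; exists p; rewrite h.
  by have [p [[a b] _]] := pp_meet plane nl; exists p; rewrite a b.
Qed.

End Regular.

(** * Distances in the incidence graph *)

Section Distance.

Variables (P L : finType) (inc : P -> L -> bool) (q : nat).
Hypothesis R : regular_plane inc q.

Let G := incidence_graph inc.

Lemma has_walk0 (V : finType) (e : rel V) x y : has_walk e x y 0 = (x == y).
Proof.
apply/existsP/eqP=> [[w]|->]; first by rewrite (tuple0 w) => /andP[_ /eqP].
by exists [tuple]; rewrite /= eqxx.
Qed.

Lemma has_walkS (V : finType) (e : rel V) x y n :
  has_walk e x y n.+1 = [exists z, e x z && has_walk e z y n].
Proof.
apply/existsP/existsP=> [[w]|[z /andP[xz /existsP[w]]]].
  case/tupleP: w => z w /= /andP[/andP[xz zw] l].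
  by exists z; rewrite xz; apply/existsP; exists w; rewrite zw.
by case/andP=> zw l; exists [tuple of z :: w]; rewrite /= xz zw.
Qed.

Lemma gdist_eq (V : finType) (e : rel V) x y n : has_walk e x y n ->
  (forall m, m < n -> ~~ has_walk e x y m) -> gdist e x y = n.
Proof.
move=> w h; have c : connect e x y.
  by case/existsP: w => w /andP[a /eqP b]; apply/connectP; exists w.
have [d1 d2] := gdistP c; apply/eqP; rewrite eqn_leq d2 //= leqNgt.
by apply/negP=> /h; rewrite d1.
Qed.

Definition plane_dist (x y : P + L) : nat :=
  match x, y with
  | inl p, inr l | inr l, inl p => if inc p l then 1 else 3
  | _, _ => if x == y then 0 else 2
  end.

(** The parity of a walk is dictated by the classes of its ends. Two points are linked through their
    join; a point [p] is linked to a line off it through any point [r] of that line and the join of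
    [p] and [r]. Lines are treated dually. *)
Lemma gdist_incidence x y : gdist G x y = plane_dist x y.
Proof.
have ex p : exists l, inc p l by have [l /andP[]] := rp_join R p p; exists l.
have ex' l : exists p, inc p l by have [p /andP[]] := rp_meet R l l; exists p.
case: x y => [p|l] [p'|l'] /=.
- case: ifP => [/eqP[->]|np]; first by apply: gdist_eq; rewrite ?has_walk0.
  have [l /andP[pl p'l]] := rp_join R p p'.
  apply: gdist_eq => [|[|[|//]] _]; rewrite ?has_walkS ?has_walk0 ?np //.
    apply/existsP; exists (inr l); rewrite /= pl /= has_walkS.
    by apply/existsP; exists (inl p'); rewrite has_walk0 /= p'l eqxx.
  by rewrite negb_exists; apply/forallP=> -[r|m] //=; rewrite has_walk0 andbC.
- case: ifP => np.
    apply: gdist_eq => [|[|//] _]; rewrite ?has_walk0 // has_walkS.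
    by apply/existsP; exists (inr l'); rewrite has_walk0 /= np eqxx.
  have [r rl'] := ex' l'; have [l /andP[pl rl]] := rp_join R p r.
  apply: gdist_eq => [|[|[|[|//]]] _]; rewrite ?has_walkS ?has_walk0 //.
  + apply/existsP; exists (inr l); rewrite /= pl /= has_walkS.
    apply/existsP; exists (inl r); rewrite /= rl /= has_walkS.
    by apply/existsP; exists (inr l'); rewrite has_walk0 /= rl' eqxx.
  + rewrite negb_exists; apply/forallP=> -[s|m] //=; rewrite has_walk0.
    by apply/negP=> /andP[pm /eqP[e]]; rewrite e np in pm.
  + rewrite negb_exists; apply/forallP=> -[s|m] //=; apply/negP=> /andP[_].
    by rewrite has_walkS => /existsP[[s|n]] //=; rewrite has_walk0 andbF.
- case: ifP => np.
    apply: gdist_eq => [|[|//] _]; rewrite ?has_walk0 // has_walkS.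
    by apply/existsP; exists (inl p'); rewrite has_walk0 /= np eqxx.
  have [m pm] := ex p'; have [r /andP[rl rm]] := rp_meet R l m.
  apply: gdist_eq => [|[|[|[|//]]] _]; rewrite ?has_walkS ?has_walk0 //.
  + apply/existsP; exists (inl r); rewrite /= rl /= has_walkS.
    apply/existsP; exists (inr m); rewrite /= rm /= has_walkS.
    by apply/existsP; exists (inl p'); rewrite has_walk0 /= pm eqxx.
  + rewrite negb_exists; apply/forallP=> -[s|n] //=; rewrite has_walk0.
    by apply/negP=> /andP[sl /eqP[e]]; rewrite e np in sl.
  + rewrite negb_exists; apply/forallP=> -[s|n] //=; apply/negP=> /andP[_].
    by rewrite has_walkS => /existsP[[t|n]] //=; rewrite has_walk0 andbF.
- case: ifP => [/eqP[->]|np]; first by apply: gdist_eq; rewrite ?has_walk0.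
  have [p /andP[pl pl']] := rp_meet R l l'.
  apply: gdist_eq => [|[|[|//]] _]; rewrite ?has_walkS ?has_walk0 ?np //.
    apply/existsP; exists (inl p); rewrite /= pl /= has_walkS.
    by apply/existsP; exists (inr l'); rewrite has_walk0 /= pl' eqxx.
  by rewrite negb_exists; apply/forallP=> -[r|m] //=; rewrite has_walk0 andbC.
Qed.

End Distance.

(** * Counting incidences with a point set *)

Lemma sum_bool (T : finType) (p : pred T) : \sum_x (p x : nat) = #|[set x | p x]|.
Proof. by rewrite -sum1dep_card [RHS]big_mkcond. Qed.

Lemma card_sum_mem (T : finType) (X : {set T}) : #|X| = \sum_x (x \in X : nat).
Proof. by rewrite sum_bool; congr #|pred_of_set _|; apply/setP=> x; rewrite inE. Qed.

Section Counting.

Variables (P L : finType) (inc : P -> L -> bool) (q : nat).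
Hypothesis R : regular_plane inc q.

Lemma sum_inc_pencil p : \sum_l (inc p l : nat) = q.+1.
Proof. by rewrite sum_bool (rp_pencil R). Qed.

Lemma sum_inc_line l : \sum_p (inc p l : nat) = q.+1.
Proof. by rewrite sum_bool (rp_line R). Qed.

Lemma sum_inc2 p r : p != r -> \sum_l (inc p l * inc r l) = 1.
Proof.
move=> npr; have [l /andP[pl rl]] := rp_join R p r.
rewrite (bigD1 l) //= pl rl big1 // => m ml.
apply/eqP; rewrite muln_eq0 !eqb0 -negb_and; apply: contra ml => /andP[pm rm].
by apply/eqP; apply: (rp_uniq R npr).
Qed.

Lemma sum_inc2_dual l m : l != m -> \sum_p (inc p l * inc p m) = 1.
Proof.
move=> nlm; have [p /andP[pl pm]] := rp_meet R l m.
rewrite (bigD1 p) //= pl pm big1 // => r rp.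
apply/eqP; rewrite muln_eq0 !eqb0 -negb_and; apply: contra nlm => /andP[rl rm].
by apply/eqP; apply: (rp_uniq R rp).
Qed.

(** Count the flags whose point is on [l0]: the line [l0] itself occurs q + 1 times, every other
    line once. *)
Lemma card_lines (l0 : L) : #|L| = q * q + q + 1.
Proof.
have : \sum_l \sum_p (inc p l * inc p l0) = q.+1 * q.+1.
  rewrite exchange_big /=; under eq_bigr => p _ do
    rewrite -big_distrl /= sum_inc_pencil.
  by rewrite -big_distrr /= sum_inc_line.
rewrite (bigD1 l0) //= (eq_bigr (fun p => inc p l0 : nat)); last first.
  by move=> p _; case: (inc p l0).
rewrite sum_inc_line (eq_bigr (fun=> 1)); last by move=> l; exact: sum_inc2_dual.
have -> : \sum_(l | l != l0) 1 = #|L|.-1 by rewrite sum1_card cardC1.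
have : 0 < #|L| by apply/card_gt0P; exists l0.
move: #|L| => n; nia.
Qed.

Variable A : {set P}.

Definition wt (l : L) := \sum_(p in A) (inc p l : nat).

Lemma sum_wt : \sum_l wt l = #|A| * q.+1.
Proof.
rewrite exchange_big /= (eq_bigr (fun=> q.+1)) ?sum_nat_const // => p _.
exact: sum_inc_pencil.
Qed.

(** Count triples of a line and two points of [A] on it. A pair (p, p) has q + 1 lines and a pair of
    distinct points has one, so each [p] contributes (q + 1) + (|A| - 1). *)
Lemma sum_wt2 : \sum_l wt l * wt l = #|A| * (#|A| + q).
Proof.
transitivity (\sum_(p in A) \sum_(r in A) \sum_l (inc p l * inc r l)).
  under [RHS]eq_bigr => p _ do rewrite exchange_big.
  rewrite exchange_big; apply: eq_bigr => l _; rewrite /wt big_distrl /=.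
  by apply: eq_bigr => p _; rewrite big_distrr.
rewrite (eq_bigr (fun=> #|A| + q)) ?sum_nat_const // => p pA.
rewrite (bigD1 p) //= (eq_bigr (fun l => inc p l : nat)); last first.
  by move=> l _; case: (inc p l).
rewrite sum_inc_pencil (eq_bigr (fun=> 1)).
  have -> : \sum_(r in A | r != p) 1 = #|A :\ p|.
    by rewrite -sum1_card; apply: eq_bigl => r; rewrite !inE andbC.
  by have := cardsD1 p A; rewrite pA; lia.
by move=> r /andP[_ rp]; apply: sum_inc2; rewrite eq_sym.
Qed.

Lemma wt_le l : wt l <= q.+1.
Proof.
rewrite -(sum_inc_line l) /wt big_mkcond; apply: leq_sum => p _.
by case: (p \in A).
Qed.

Lemma wt_eq0 l : (wt l == 0) = [forall p in A, ~~ inc p l].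
Proof.
rewrite /wt sum_nat_eq0; apply: eq_forallb => p.
by case: (p \in A); case: (inc p l).
Qed.

Lemma wt_eq1 l p : p \in A -> inc p l ->
  (wt l == 1) = [forall (r | (r \in A) && (r != p)), ~~ inc r l].
Proof.
move=> pA pl; rewrite /wt (bigD1 p) //= pl eqSS sum_nat_eq0.
by apply: eq_forallb => r; case: (r \in A); case: (r != p); case: (inc r l).
Qed.

Variable B : {set L}.

Definition skew_condition :=
  #|[set l | (l \notin B) && (wt l == 0)]| <= 1.

Definition tangent_condition := forall p, p \in A ->
  #|[set l | [&& l \notin B, wt l == 1 & inc p l]]| <= 1.

Hypotheses (skewB : skew_condition) (tangentB : tangent_condition).

Let outer_tangent l : nat := (l \notin B) && (wt l == 1).
Let outer_skew l : nat := (l \notin B) && (wt l == 0).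

Lemma sum_outer_skew : \sum_l outer_skew l <= 1.
Proof. by rewrite sum_bool. Qed.

Lemma sum_inner : \sum_l (l \in B : nat) = #|B|.
Proof. by rewrite sum_bool cardsE. Qed.

Lemma sum_outer_tangent_at (D : pred P) : {subset D <= A} ->
  \sum_(p | D p) \sum_l (inc p l * outer_tangent l) <= \sum_(p | D p) 1.
Proof.
move=> sD; apply: leq_sum => p /sD /tangentB; apply: leq_trans.
rewrite -sum1dep_card [leqRHS]big_mkcond; apply: leq_sum => l _ /=.
by rewrite /outer_tangent; case: (l \notin B); case: (wt l == 1); case: inc.
Qed.

(** A tangent outside [B] is charged to its only point of [A]. *)
Lemma sum_outer_tangent : \sum_l outer_tangent l <= #|A|.
Proof.
have := @sum_outer_tangent_at (mem A) (fun p => id).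
rewrite [in leqRHS]sum1_card; apply: leq_trans.
rewrite exchange_big; apply: leq_sum => l _ /=.
rewrite -big_distrl /= -/(wt l) /outer_tangent.
by case: eqP => [->|_]; rewrite ?andbF // mul1n.
Qed.

(** Consider the lines other than [l] through the points of [l] outside [A]. Each has two points of
    [A], or is in [B], or is skew, or is tangent. The product on the right counts pairs of a point
    of [l] outside [A] and a point of [A] off [l], each pair having one join; the last term pays for
    the tangents. *)
Lemma count_lines_meeting_off l :
  2 * (q * (q.+1 - wt l)) <=
  (q.+1 - wt l) * (#|A| - wt l) + 2 * #|B| + 2 + (#|A| - wt l).
Proof.
pose E p := inc p l && (p \notin A).
pose F p := (p \in A) && ~~ inc p l.
have cE : \sum_(p | E p) 1 = q.+1 - wt l.
  have: \sum_(p | E p) 1 + wt l = q.+1; last by lia.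
  rewrite -(sum_inc_line l) /wt big_mkcond [X in _ + X]big_mkcond -big_split /=.
  by apply: eq_bigr => p _; rewrite /E; case: (p \in A); case: inc.
have cF : \sum_(p | F p) 1 = #|A| - wt l.
  have: \sum_(p | F p) 1 + wt l = #|A|; last by lia.
  rewrite -sum1_card /wt big_mkcond [X in _ + X]big_mkcond -big_split /= big_mkcond.
  rewrite [RHS]big_mkcond.
  by apply: eq_bigr => p _; rewrite /F; case: (p \in A); case: inc.
pose c g := \sum_(r | E r) (inc r g : nat).
have c_le1 g : g != l -> c g <= 1.
  move=> gl; rewrite -(sum_inc2_dual gl) /c big_mkcond; apply: leq_sum => r _.
  by rewrite /E; case: (inc r l); case: (r \in A) => //=; rewrite muln1.
have sc : \sum_(g | g != l) c g = q * (q.+1 - wt l).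
  rewrite exchange_big /= (eq_bigr (fun=> q * 1)); last first.
    move=> r /andP[rl _]; have := sum_inc_pencil r.
    by rewrite (bigD1 l) //= rl; lia.
  by rewrite -big_distrr /= cE.
(* Such a line meets [l] only in a point outside [A], so all its points of [A] are off [l]. *)
have cw g : g != l -> c g != 0 -> wt g = \sum_(p | F p) (inc p g : nat).
  move=> gl; rewrite /c sum_nat_eq0 negb_forall => /existsP[r].
  rewrite negb_imply => /andP[/andP[rl rA]]; rewrite eqb0 negbK => rg.
  rewrite /wt big_mkcond [RHS]big_mkcond; apply: eq_bigr => p _; rewrite /F.
  case pA: (p \in A) => //=; case pl: (inc p l) => //=; case pg: (inc p g) => //.
  have npr : p != r by apply: contraNneq rA => <-.
  by case/eqP: gl; apply: (rp_uniq R npr).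
have scw : \sum_(g | g != l) c g * wt g <= (q.+1 - wt l) * (#|A| - wt l).
  apply: (@leq_trans (\sum_g \sum_(r | E r) \sum_(p | F p) (inc r g * inc p g))).
    rewrite big_mkcond; apply: leq_sum => g _; case: ifP => // gl.
    have [->//|c0] := eqVneq (c g) 0; rewrite (cw g) // big_distrl /=.
    by apply: leq_sum => r _; rewrite big_distrr.
  rewrite exchange_big /= -cE -cF big_distrl /=; apply: leq_sum => r /andP[rl rA].
  rewrite mul1n exchange_big /=; apply: leq_sum => p /andP[pA pl].
  by rewrite sum_inc2 //; apply: contraNneq rA => ->.
have sct : \sum_(g | g != l) c g * outer_tangent g <= #|A| - wt l.
  rewrite -cF; apply: leq_trans (sum_outer_tangent_at _); last by move=> p /andP[].
  rewrite exchange_big big_mkcond; apply: leq_sum => g _; case: ifP => // gl.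
  rewrite -big_distrl /=; have [->//|c0] := eqVneq (c g) 0.
  rewrite -cw // /outer_tangent; case: eqP => [->|_]; rewrite ?andbF ?muln0 //.
  by rewrite leq_mul2r c_le1 ?orbT.
have sci : \sum_(g | g != l) (g \in B : nat) <= #|B|.
  by rewrite -sum_inner big_mkcond; apply: leq_sum => g _; case: ifP.
have scs : \sum_(g | g != l) outer_skew g <= 1.
  apply: leq_trans sum_outer_skew; rewrite big_mkcond.
  by apply: leq_sum => g _; case: ifP.
suff : \sum_(g | g != l) 2 * c g <= \sum_(g | g != l)
   (c g * wt g + 2 * (g \in B) + 2 * outer_skew g + c g * outer_tangent g).
  rewrite -big_distrr 3!big_split /= -!big_distrr /= sc; lia.
apply: leq_sum => g gl; move: (c_le1 g gl); rewrite /outer_skew /outer_tangent.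
by case: (c g) => [|[|]] //; case: (g \in B) => //=; case: (wt g) => [|[|]] //=; lia.
Qed.

(** The same alternative, summed over all lines of the plane. *)
Lemma line_cover_lower (l0 : L) :
  2 * (q * q + q + 1) <= #|A| * q.+1 + 2 * #|B| + 2 + #|A|.
Proof.
rewrite -sum_wt -sum_inner; move: sum_outer_skew sum_outer_tangent.
suff : \sum_(g : L) 2 <= \sum_g
   (wt g + 2 * (g \in B) + 2 * outer_skew g + outer_tangent g).
  rewrite sum_nat_const (card_lines l0) 3!big_split /= -!big_distrr /=; lia.
apply: leq_sum => g _; rewrite /outer_skew /outer_tangent.
by case: (g \in B) => //=; case: (wt g) => [|[|]] //=; lia.
Qed.

Hypotheses (q_ge : 23 <= q) (A_le : #|A| + 3 <= 2 * q)
  (AB_le : #|A| + #|B| + 5 <= 4 * q).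

(** Inserting |B| <= 4q - 5 - |A| leaves |A|q >= 2q^2 - 6q + 10, hence |A| > 2q - 6. *)
Lemma card_A_lower (l0 : L) : 2 * q <= #|A| + 5.
Proof. by have := line_cover_lower l0; nia. Qed.

(** For x = [wt l] in the middle range the bounds on |A| and |B| give (q + 1 - x)(x + 3) + x <= 6q -
    5. The left side is concave in x and too large at x = 4 and x = q - 5, hence also in between. *)
Lemma short_or_long (l0 : L) l : wt l <= 3 \/ q <= wt l + 4.
Proof.
have := count_lines_meeting_off l; have := wt_le l; have b5 := card_A_lower l0.
have : wt l <= #|A|.
  rewrite /wt -sum1_card; apply: leq_sum => p _; exact: leq_b1.
move: (wt l) => x xA xq.
have [|x3] := leqP x 3; [by left|right; rewrite leqNgt; apply/negP=> xlt].
have [y yE] : exists y, q = x + 5 + y by exists (q - x - 5); lia.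
nia.
Qed.

Lemma two_long_lines (l0 : L) :
  exists e f, [/\ e != f, q <= wt e + 4 & q <= wt f + 4].
Proof.
pose G := [set l | q <= wt l + 4].
have [/card_gt1P[e [f [eG fG ef]]]|G1] := boolP (1 < #|G|).
  by exists e, f; rewrite !inE in eG fG; split.
exfalso; have b5 := card_A_lower l0.
(* w^2 - 5w + 6 = (w - 2)(w - 3) vanishes on 2- and 3-secants, so a short line is
   charged only if it is skew or tangent. *)
have : \sum_(g : L) (wt g * wt g + 6) <= \sum_g (5 * wt g + 6 * (g \in B) +
  6 * outer_skew g + 2 * outer_tangent g + (g \in G) * (q * q - 3 * q + 2)).
  apply: leq_sum => g _; rewrite inE; have [s|l] := short_or_long l0 g.
    rewrite /outer_skew /outer_tangent; case: (g \in B) => /=;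
    by move: (wt g) s => [|[|[|[|]]]] //=; lia.
  (* On a long line (w - 2)(w - 3) is largest at w = q + 1, where it is (q - 1)(q - 2). *)
  rewrite l mul1n; have := wt_le g; nia.
rewrite 5!big_split /= -!big_distrr -big_distrl /= sum_nat_const sum_wt sum_wt2.
rewrite (card_lines l0) sum_inner sum_bool cardsE.
(* With |A| = 2q - t and 3 <= t <= 5 the inequality becomes q^2 - 17q + t^2 + t + 28 <= 0, which is
   false for q >= 23. *)
move: sum_outer_skew sum_outer_tangent; nia.
Qed.

End Counting.

(* x, y points of A and a, b missing points on the two long lines, apart from their
   intersection O; d further points of A; o tells whether O is in A; F lines through
   O; c0, ..., c3 inner lines through O, through exactly one missing point (c1, c2),
   and through two missing points. *)
Lemma two_long_lines_arith (q x y a b nA nB c0 c1 c2 c3 F d : nat) (o : bool) :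
  23 <= q -> nA + nB + 5 <= 4 * q -> nA + 3 <= 2 * q ->
  q <= o + x + 4 -> q <= o + y + 4 -> c0 + c1 + c2 + c3 <= nB ->
  (~~ o -> d = 0 -> F + a * b <= c0 + c3 + 1) ->
  y * a <= c2 + d * a + y -> x * b <= c1 + d * b + x ->
  F <= c0 + d + 1 -> F + 2 = q.+1 -> nA = o + x + y + d ->
  y + b = q -> x + a = q -> 2 * q <= nA + 5 -> False.
Proof.
move=> H0 H1 H2 H3 H4 H5 H6 H7 H8 H9 H10 H11 H12 H13 H14.
(* A long line has at least q - 4 points of [A], one of which may be O, so at most 5 of its other q
   points are missing. *)
have a5 : a <= 5 by lia.
have b5 : b <= 5 by lia.
have {}H6 : o \/ d <> 0 \/ F + a * b <= c0 + c3 + 1.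
  by case: o H6 {H3 H4 H11} => [|/(_ isT) H6]; [left|right; lia].
(* Once [a] and [b] are numerals, all products are linear. *)
clear H14; destruct a as [|[|[|[|[|[|a]]]]]]; try (exfalso; lia);
  destruct b as [|[|[|[|[|[|b]]]]]]; lia.
Qed.

(** * The lines determined by two long lines *)

Section TwoLongLines.

Variables (P L : finType) (inc : P -> L -> bool) (q : nat).
Hypothesis R : regular_plane inc q.
Variables (A : {set P}) (B : {set L}).
Hypotheses (skewB : skew_condition inc A B) (tangentB : tangent_condition inc A B).

Definition join p r := xchoose (rp_join R p r).
Definition meet l m := xchoose (rp_meet R l m).

Lemma joinP p r : inc p (join p r) /\ inc r (join p r).
Proof. exact/andP/(xchooseP (rp_join R p r)). Qed.

Lemma meetP l m : inc (meet l m) l /\ inc (meet l m) m.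
Proof. exact/andP/(xchooseP (rp_meet R l m)). Qed.

Lemma join_unique p r l : p != r -> inc p l -> inc r l -> join p r = l.
Proof. by have [a b] := joinP p r; move=> pr c d; apply: (rp_uniq R pr). Qed.

Lemma meet_unique l m p : l != m -> inc p l -> inc p m -> meet l m = p.
Proof.
have [a b] := meetP l m; move=> lm c d; apply/eqP; apply: contraNT lm => n.
by apply/eqP/(rp_uniq R n).
Qed.

Definition side (O : P) l a := [set u | [&& inc u l, u != O & (u \in A) == a]].
Definition off e f := [set p in A | ~~ inc p e && ~~ inc p f].
(** For O on [e] and [f], the lines other than these two fall into the [fan] and the four [cross]
    classes, told apart by whether the meets with [e] and [f] are in [A]. *)
Definition fan O e f := [set g | [&& inc O g, g != e & g != f]].
Definition cross O e f a c :=
  [set g | [&& ~~ inc O g, (meet g e \in A) == a & (meet g f \in A) == c]].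

Lemma cross_swap O e f a c : cross O e f a c = cross O f e c a.
Proof. by apply/setP=> g; rewrite !inE [(_ == a) && _]andbC. Qed.

Lemma off_swap e f : off e f = off f e.
Proof. by apply/setP=> p; rewrite !inE [~~ _ && _]andbC. Qed.

Section Pair.

Variables (O : P) (e f : L).
Hypotheses (Oe : inc O e) (Of : inc O f) (ef : e != f).

Local Notation Z := (off e f).
Local Notation z g := (wt inc Z g).

Lemma card_side : #|side O e true| + #|side O e false| = q.
Proof.
have := sum_inc_line R e; rewrite (bigD1 O) //= Oe -!sum_bool -big_split /=.
move=> [<-]; rewrite [RHS]big_mkcond; apply: eq_bigr => u _.
by case: (u != O); case: (u \in A); case: inc.
Qed.

Lemma wt_side : wt inc A e = (O \in A) + #|side O e true|.
Proof.
rewrite /wt big_mkcond (bigD1 O) //= Oe -sum_bool; congr (_ + _).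
rewrite big_mkcond; apply: eq_bigr => u _.
by case: (u != O); case: (u \in A); case: inc.
Qed.

Lemma on_both p : inc p e -> inc p f -> p = O.
Proof. by move=> pe pf; rewrite -(meet_unique ef pe pf) (meet_unique ef Oe Of). Qed.

Lemma card_split : #|A| = (O \in A) + #|side O e true| + #|side O f true| + #|Z|.
Proof.
rewrite -sum1_card big_mkcond (bigD1 O) //= -!addnA; congr (_ + _).
rewrite -!sum_bool.
have -> : \sum_p ((p \in A) && (~~ inc p e && ~~ inc p f) : nat) =
  \sum_(p | p != O) ((p \in A) && (~~ inc p e && ~~ inc p f) : nat).
  by rewrite (bigD1 O) //= Oe andbF.
have S l : \sum_u ([&& inc u l, u != O & (u \in A) == true] : nat) =
  \sum_(u | u != O) (inc u l && (u \in A) : nat).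
  rewrite [RHS]big_mkcond; apply: eq_bigr => u _.
  by case: (u != O); case: (u \in A); case: inc.
rewrite !S -!big_split; apply: eq_bigr => p pO /=.
case: (p \in A); last by rewrite !andbF.
case pe: (inc p e); case pf: (inc p f) => //=.
by rewrite (on_both pe pf) eqxx in pO.
Qed.

Lemma card_fan : #|fan O e f| + 2 = q.+1.
Proof.
rewrite -(sum_inc_pencil R O) (bigD1 e) //= (bigD1 f) 1?eq_sym //= Oe Of.
rewrite -sum_bool addnA addnC; congr (_ + _).
rewrite [RHS]big_mkcond; apply: eq_bigr => g _.
by case: (g != e); case: (g != f); case: inc.
Qed.

(** Joining u on [e] to v on [f] is injective, because u and v are the meets of the join with [e]
    and [f]. *)
Lemma card_cross a c : #|side O e a| * #|side O f c| <= #|cross O e f a c|.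
Proof.
rewrite -cardsX.
have H u v : u \in side O e a -> v \in side O f c ->
    let g := join u v in [/\ ~~ inc O g, meet g e = u & meet g f = v].
  rewrite !inE => /and3P[ue uO uA] /and3P[vf vO vA] g.
  have [ug vg] := joinP u v; rewrite -/g in ug vg.
  have Og : ~~ inc O g.
    apply/negP=> Og; have E := rp_uniq R uO ug Og ue Oe.
    by have := rp_uniq R vO vg Og vf Of; rewrite E => eqef; move: ef; rewrite eqef eqxx.
  split=> //; apply: meet_unique => //; apply: contraNneq Og => ->; done.
rewrite -(@card_in_imset _ _ (fun uv => join uv.1 uv.2)).
  apply/subset_leq_card/subsetP=> g /imsetP[[u v]]; rewrite in_setX => /andP[hu hv] ->.
  have [h1 h2 h3] := H _ _ hu hv; rewrite inE h1 h2 h3 /=.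
  by move: hu hv; rewrite !inE => /and3P[_ _ ->] /and3P[_ _ ->].
move=> [u v] [u' v']; rewrite !in_setX /= => /andP[hu hv] /andP[hu' hv'] E.
have [_ h2 h3] := H _ _ hu hv; have [_ h2' h3'] := H _ _ hu' hv'.
by move: h2 h3; rewrite E h2' h3' => -> ->.
Qed.

(** A line of the fan meets [e] and [f] only in O, and a line avoiding O ([wt_cross]) meets them in
    two distinct points; its other points of [A] are in [Z]. *)
Lemma wt_fan g : g \in fan O e f -> wt inc A g = (O \in A) + z g.
Proof.
rewrite inE => /and3P[Og ge gf].
rewrite /wt big_mkcond (bigD1 O) //= Og [X in _ = _ + X]big_mkcond.
rewrite [X in _ = _ + X](bigD1 O) //= [in RHS]inE Oe andbF add0n.
congr (_ + _); apply: eq_bigr => p pO; rewrite inE.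
case pg: (inc p g); last by rewrite !if_same.
have np l : inc O l -> g != l -> ~~ inc p l.
  by move=> Ol; apply: contra => pl; apply/eqP/(rp_uniq R pO).
by rewrite !np //; case: (p \in A).
Qed.

Lemma wt_cross g : ~~ inc O g ->
  wt inc A g = (meet g e \in A) + (meet g f \in A) + z g.
Proof.
move=> Og.
have ge : g != e by apply: contraNneq Og => ->.
have gf : g != f by apply: contraNneq Og => ->.
have S a : (a \in A : nat) = \sum_p ((p == a) && (p \in A) : nat).
  by rewrite (bigD1 a) //= eqxx big1 ?addn0 // => i /negbTE ->.
rewrite !S /wt big_mkcond [X in _ = _ + X]big_mkcond -!big_split.
apply: eq_bigr => p _ /=; rewrite inE.
have E l : g != l -> (p == meet g l) = inc p g && inc p l.
  move=> gl; apply/eqP/andP=> [->|[a b]]; [exact: meetP|].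
  by rewrite (meet_unique gl a b).
rewrite !E //; case: (p \in A); rewrite ?andbF //=.
case pg: (inc p g) => //=; last by rewrite if_same.
case pe: (inc p e); case pf: (inc p f) => //=.
by rewrite -(on_both pe pf) pg in Og.
Qed.

Lemma inner_lines_lower (G : {set L}) :
  #|G| <= #|B :&: G| + \sum_(g in G) z g +
          #|[set g in G | (g \notin B) && (z g == 0)]|.
Proof.
rewrite -!sum1_card [X in X + _ + _]big_mkcond [X in _ <= _ + X]big_mkcond.
rewrite [leqLHS]big_mkcond [X in _ + X + _]big_mkcond -!big_split.
apply: leq_sum => g _ /=; rewrite !inE.
by case: (g \in G); case: (g \in B) => //=; case: (z g).
Qed.

Lemma sum_off (G : {set L}) k :
  (forall p, p \in Z -> #|[set g in G | inc p g]| <= k) ->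
  \sum_(g in G) z g <= #|Z| * k.
Proof.
move=> h; rewrite exchange_big /= -sum_nat_const; apply: leq_sum => p /h.
apply: leq_trans; rewrite -sum_bool big_mkcond.
by apply: leq_sum => g _; case: (g \in G).
Qed.

(** Each point of [Z] is on one line through O. A fan line without points of [Z] is tangent at O if
    O is in [A] and skew otherwise, so at most one such line is outside [B]. *)
Lemma fan_lower : #|fan O e f| <= #|B :&: fan O e f| + #|Z| + 1.
Proof.
apply: leq_trans (inner_lines_lower _) _; rewrite leq_add ?leq_add2l //.
  rewrite -[leqRHS]muln1; apply: sum_off => p; rewrite inE => /and3P[_ pe _].
  have Op : O != p by apply: contraNneq pe => <-.
  rewrite -(sum_inc2 R Op) -sum_bool; apply: leq_sum => g _.
  by rewrite inE; case: (inc O g); case: (inc p g); rewrite ?andbF //= leq_b1.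
case OA: (O \in A).
  apply: leq_trans (tangentB OA); apply/subset_leq_card/subsetP=> g.
  rewrite inE => /and3P[gf gB /eqP z0]; rewrite inE gB wt_fan // z0 OA /=.
  by move: gf; rewrite inE => /and3P[].
apply: leq_trans skewB; apply/subset_leq_card/subsetP=> g.
by rewrite inE => /and3P[gf gB /eqP z0]; rewrite inE gB wt_fan // z0 OA.
Qed.

(** Without points of [Z], the join of a point u of [A] on [e] to a missing point of [f] is tangent
    at u, so each u has at most one such join outside [B]. A point of [Z] is on at most one join per
    missing point of [f]. *)
Lemma cross_lower : #|side O e true| * #|side O f false| <=
  #|B :&: cross O e f true false| + #|Z| * #|side O f false| + #|side O e true|.
Proof.
apply: leq_trans (card_cross _ _) _.
apply: leq_trans (inner_lines_lower _) _; rewrite leq_add ?leq_add2l //.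
  apply: sum_off => p; rewrite inE => /and3P[pA pe pf].
  apply: leq_trans (leq_imset_card (join p) _).
  apply/subset_leq_card/subsetP=> g; rewrite !inE => /andP[/and3P[Og _ nA] pg].
  have [m1 m2] := meetP g f; apply/imsetP; exists (meet g f).
    by rewrite inE m2 nA andbT; apply: contraNneq Og => <-.
  by rewrite (join_unique _ pg m1) //; apply: contraNneq pf => ->.
rewrite -[leqRHS]sum1_card.
apply: (@leq_trans (\sum_(u in side O e true)
    #|[set l | [&& l \notin B, wt inc A l == 1 & inc u l]]|)); last first.
  by apply: leq_sum => u; rewrite inE eqb_id => /and3P[_ _]; exact: tangentB.
under eq_bigr => u _ do rewrite -sum_bool.
rewrite exchange_big -sum1_card big_mkcond; apply: leq_sum => g _ /=.
case: ifP => //; rewrite !inE => /and3P[/and3P[Og mA nA] gB /eqP z0].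
have [m1 m2] := meetP g e.
rewrite (bigD1 (meet g e)) /=; last first.
  by rewrite inE m2 mA andbT; apply: contraNneq Og => <-.
by rewrite gB m1 wt_cross // z0 (eqP mA) (eqP nA).
Qed.

(** Here all lines of both classes are skew, so all but one are in [B]. *)
Lemma skew_lower : O \notin A -> #|Z| = 0 ->
  #|fan O e f| + #|side O e false| * #|side O f false| <=
  #|B :&: fan O e f| + #|B :&: cross O e f false false| + 1.
Proof.
move=> OA Z0; apply: leq_trans (leq_add (leqnn _) (card_cross _ _)) _.
have z0 g : z g = 0 by rewrite /wt (cards0_eq Z0) big_set0.
apply: leq_trans (leq_add (leqnn _) skewB); rewrite !card_sum_mem -!big_split.
apply: leq_sum => g _ /=; rewrite !inE.
case gf: [&& _, _ & _] => /=.
  rewrite (wt_fan (g := g)) ?inE // z0 (negbTE OA); case/and3P: gf => -> _ _ /=.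
  by case: (g \in B).
case gc: [&& _, _ & _] => //=; case/and3P: gc => Og /eqP h1 /eqP h2.
by rewrite wt_cross // h1 h2 z0; case: (g \in B).
Qed.

Lemma inner_upper : #|B :&: fan O e f| + #|B :&: cross O e f true false| +
  #|B :&: cross O e f false true| + #|B :&: cross O e f false false| <= #|B|.
Proof.
rewrite !card_sum_mem -!big_split.
apply: leq_sum => g _ /=; rewrite !inE.
case: (g \in B) => //=; case: (inc O g) => //=; first by case: (_ && _).
by case: (meet g e \in A); case: (meet g f \in A).
Qed.

End Pair.

Hypotheses (q_ge : 23 <= q) (A_le : #|A| + 3 <= 2 * q)
  (AB_le : #|A| + #|B| + 5 <= 4 * q).

Lemma no_small_resolving (l0 : L) : False.
Proof.
have [e [f [ef we wf]]] := two_long_lines R skewB tangentB q_ge A_le AB_le l0.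
have [O /andP[Oe Of]] := rp_meet R e f.
have fe : f != e by rewrite eq_sym.
rewrite (wt_side Oe) in we; rewrite (wt_side Of) in wf.
have := card_A_lower R skewB tangentB q_ge A_le AB_le l0.
have := card_side Oe; have := card_side Of; have := card_split Oe Of ef.
have := card_fan Oe Of ef; have := fan_lower Oe Of.
have := cross_lower Oe Of ef; have := cross_lower Of Oe fe.
(* The bound with [e] and [f] exchanged is rewritten into the classes of the pair [e], [f]. *)
rewrite [cross O f e _ _]cross_swap (off_swap f e).
have := skew_lower Oe Of ef; have := inner_upper O e f.
move: AB_le A_le we wf.
move: #|B :&: fan _ _ _| #|fan _ _ _| #|off _ _|.
move: #|B :&: cross _ _ _ true false| #|B :&: cross _ _ _ false true|.
move: #|B :&: cross _ _ _ false false|.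
move: #|side _ e true| #|side _ f true| #|side _ e false| #|side _ f false| #|A| #|B|.
clear -q_ge.
move=> x y a b nA nB c3 c1 c2 c0 F d.
exact: two_long_lines_arith.
Qed.

End TwoLongLines.

(** * Resolving sets as separating pairs *)

Definition separates (P L : finType) (inc : P -> L -> bool)
    (A : {set P}) (B : {set L}) : Prop :=
  forall l m, l \notin B -> m \notin B ->
    (forall p, p \in A -> inc p l = inc p m) -> l = m.

Definition points_of (P L : finType) (S : {set P + L}) := [set p | inl p \in S].
Definition lines_of (P L : finType) (S : {set P + L}) := [set l | inr l \in S].

Lemma card_points_lines (P L : finType) (S : {set P + L}) :
  #|S| = #|points_of S| + #|lines_of S|.
Proof. by rewrite -!sum1dep_card -sum1_card big_sumType. Qed.

Section Separation.

Variables (P L : finType) (inc : P -> L -> bool) (q : nat).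
Hypothesis R : regular_plane inc q.

(** Skew lines share the empty trace on [A]; likewise, the tangents at p share the trace {p}. *)
Lemma separates_skew A B : separates inc A B -> skew_condition inc A B.
Proof.
move=> sep; apply/card_le1_eqP=> l m; rewrite !inE !wt_eq0.
move=> /andP[lB /forall_inP l0] /andP[mB /forall_inP m0].
by apply: sep => // p pA; rewrite (negbTE (l0 p pA)) (negbTE (m0 p pA)).
Qed.

Lemma separates_tangent A B : separates inc A B -> tangent_condition inc A B.
Proof.
move=> sep p pA; apply/card_le1_eqP=> l m; rewrite !inE.
move=> /and3P[lB l1 pl] /and3P[mB m1 pm].
rewrite (wt_eq1 pA) // in l1; rewrite (wt_eq1 pA) // in m1.
apply: sep => // r rA; have [->|rp] := eqVneq r p; first by rewrite pl pm.
have := forallP l1 r; have := forallP m1 r.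
by rewrite rA rp /= => /negbTE-> /negbTE->.
Qed.

Variable S : {set P + L}.

(** A line outside [S] is at distance 2 from every line of [S], so only its incidences with points
    of [S] distinguish it from other such lines; dually for points. *)
Lemma resolving_separates : resolving_set (incidence_graph inc) S ->
  separates inc (points_of S) (lines_of S) /\
  separates (dual inc) (lines_of S) (points_of S).
Proof.
move/injectiveP=> injS; split=> [l m|p r]; rewrite !inE => lS mS h.
  suff: inr l = inr m :> P + L by case.
  apply: injS; apply/eq_in_map=> -[p|n]; rewrite mem_enum => sS.
    by rewrite !(gdist_incidence R) /= h // inE.
  rewrite !(gdist_incidence R) /= !ifF //; apply/eqP=> -[E].
    by rewrite E sS in mS.
  by rewrite E sS in lS.
suff: inl p = inl r :> P + L by case.
apply: injS; apply/eq_in_map=> -[s|n]; rewrite mem_enum => sS.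
  rewrite !(gdist_incidence R) /= !ifF //; apply/eqP=> -[E].
    by rewrite E sS in mS.
  by rewrite E sS in lS.
by rewrite !(gdist_incidence R) /=; have := h n; rewrite inE /dual => ->.
Qed.

(** Members of [S] are recognised by distance 0, and any member of [S] tells points from lines by
    parity. *)
Lemma separates_resolving : 0 < #|S| ->
  separates inc (points_of S) (lines_of S) ->
  separates (dual inc) (lines_of S) (points_of S) ->
  resolving_set (incidence_graph inc) S.
Proof.
move=> /card_gt0P[s sS] sepL sepP.
apply/injectiveP=> x y /eq_in_map E.
have {}E v : v \in S -> plane_dist inc x v = plane_dist inc y v.
  by move=> vS; rewrite -!(gdist_incidence R); apply: E; rewrite mem_enum.
case: x y E => [p|l] [r|m] E.
- congr inl; have [pS|pS] := boolP (inl p \in S).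
    by have := E _ pS; rewrite /= eqxx; case: ifP => // /eqP[->].
  have [rS|rS] := boolP (inl r \in S).
    by have := E _ rS; rewrite /= eqxx; case: ifP => // /eqP[->].
  apply: sepP; rewrite ?inE // => n; rewrite inE => /E /=; rewrite /dual.
  by do 2!case: ifP.
- by have := E s sS; case: s {sS} => t /=; do 2!case: ifP.
- by have := E s sS; case: s {sS} => t /=; do 2!case: ifP.
- congr inr; have [pS|pS] := boolP (inr l \in S).
    by have := E _ pS; rewrite /= eqxx; case: ifP => // /eqP[->].
  have [rS|rS] := boolP (inr m \in S).
    by have := E _ rS; rewrite /= eqxx; case: ifP => // /eqP[->].
  apply: sepL; rewrite ?inE // => n; rewrite inE => /E /=.
  by do 2!case: ifP.
Qed.

End Separation.

(** * The resolving set with 4q - 4 elements *)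

Section Construction.

Variables (P L : finType) (inc : P -> L -> bool) (q : nat).
Hypotheses (R : regular_plane inc q) (q_gt2 : 2 < q).

Definition arm l (O r : P) := [set p | inc p l] :\ O :\ r.

Lemma card_arm l O r : inc O l -> inc r l -> r != O -> #|arm l O r| = q.-1.
Proof.
move=> Ol rl rO; have := rp_line R l.
by rewrite (cardsD1 O) (cardsD1 r) !inE Ol rl rO /=; rewrite -/(arm l O r); lia.
Qed.

Lemma arm_trace_determines l m O r (A : {set P}) :
  inc O l -> inc r l -> r != O -> arm l O r \subset A ->
  (forall p, p \in A -> inc p l = inc p m) -> m = l.
Proof.
move=> Ol rl rO sA h; have : 1 < #|arm l O r| by rewrite card_arm //; lia.
case/card_gt1P=> u [v [ua va uv]].
have inl w : w \in arm l O r -> inc w l /\ inc w m.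
  move=> wa; rewrite -h ?(subsetP sA) //.
  by move: wa; rewrite !inE => /and3P[].
by have [a b] := inl _ ua; have [c d] := inl _ va; apply: (rp_uniq R uv).
Qed.

(** The arm lacks only O and [r] among the points of [e]. A line avoiding O thus shows its meet with
    [e] in its trace, unless this meet is [r], and then the trace on the arm is empty. *)
Lemma arm_trace_meet l e O r u v m (A : {set P}) :
  arm e O r \subset A -> (forall p, p \in A -> inc p l = inc p m) ->
  ~~ inc O l -> ~~ inc O m -> inc O e ->
  inc u l -> inc u e -> inc v m -> inc v e -> u = v.
Proof.
move=> sA h Ol Om Oe ul ue vm ve.
have le : l != e by apply: contraNneq Ol => ->.
have me : m != e by apply: contraNneq Om => ->.
have uO : u != O by apply: contraNneq Ol => <-.
have vO : v != O by apply: contraNneq Om => <-.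
apply/eqP; apply: contraT => uv.
have H w : w != r -> w != O -> inc w e -> inc w l = inc w m.
  by move=> wr wO we; apply/h/(subsetP sA); rewrite !inE wr wO we.
have [ur|ur] := eqVneq u r; last first.
  have um : inc u m by rewrite -H.
  by case/eqP: me; apply: (rp_uniq R uv).
have vl : inc v l by rewrite H // -ur eq_sym.
by case/eqP: le; apply: (rp_uniq R uv).
Qed.

(** The lines [e] and [f] are recognised by their arms. Any other line outside [B] avoids O and is
    the join of its distinct meets with [e] and [f], which the trace determines. *)
Lemma arms_separate O e f r b (B : {set L}) :
  inc O e -> inc O f -> e != f -> inc r e -> r != O -> inc b f -> b != O ->
  (forall g, inc O g -> g != e -> g != f -> g \in B) ->
  separates inc (arm e O r :|: arm f O b) B.
Proof.
move=> Oe Of ef re rO bf bO hB l m lB mB h.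
have h' p : p \in arm e O r :|: arm f O b -> inc p m = inc p l by move/h.
have sE : arm e O r \subset arm e O r :|: arm f O b by exact: subsetUl.
have sF : arm f O b \subset arm e O r :|: arm f O b by exact: subsetUr.
have [le|le] := eqVneq l e.
  by rewrite le in h *; rewrite (arm_trace_determines Oe re rO sE h).
have [lf|lf] := eqVneq l f.
  by rewrite lf in h *; rewrite (arm_trace_determines Of bf bO sF h).
have [me|me] := eqVneq m e.
  by rewrite me in h' *; rewrite (arm_trace_determines Oe re rO sE h').
have [mf|mf] := eqVneq m f.
  by rewrite mf in h' *; rewrite (arm_trace_determines Of bf bO sF h').
have Ol : ~~ inc O l by apply: contra lB => Ol; apply: hB.
have Om : ~~ inc O m by apply: contra mB => Om; apply: hB.
have [u /andP[ul ue]] := rp_meet R l e; have [v /andP[vl vf]] := rp_meet R l f.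
have [u' /andP[um ue']] := rp_meet R m e; have [v' /andP[vm vf']] := rp_meet R m f.
have E := arm_trace_meet sE h Ol Om Oe ul ue um ue'.
have F := arm_trace_meet sF h Ol Om Of vl vf vm vf'.
subst u' v'; have uO : u != O by apply: contraNneq Ol => <-.
have uv : u != v.
  apply/eqP=> uv; subst v; case/eqP: ef; exact: (rp_uniq R uO).
exact: (rp_uniq R uv).
Qed.

End Construction.

Lemma exists_other (P L : finType) (inc : P -> L -> bool) q l p :
  regular_plane inc q -> 0 < q -> exists2 r, inc r l & r != p.
Proof.
move=> R q0; have := rp_line R l; rewrite (cardsD1 p) => h.
have /card_gt0P[r] : 0 < #|[set p | inc p l] :\ p|.
  by move: h; case: (p \in _); lia.
by rewrite !inE => /andP[rp rl]; exists r.
Qed.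

(* The configuration is self-dual under O <-> e, r <-> f, b <-> n. *)
Lemma small_resolving_set (P L : finType) (inc : P -> L -> bool) q (O : P) :
  regular_plane inc q -> 2 < q ->
  exists2 S, resolving_set (incidence_graph inc) S & #|S| <= 4 * q - 4.
Proof.
move=> R q2; have D := regular_plane_dual R; have q0 : 0 < q by lia.
have [e /andP[Oe _]] := rp_join R O O.
have [f Of fe] := exists_other O e D q0.
have [r re rO] := exists_other e O R q0.
have [b bf bO] := exists_other f O R q0.
have [n rn ne] := exists_other r e D q0.
rewrite /dual in Of rn.
pose A := arm inc e O r :|: arm inc f O b.
pose B := arm (dual inc) O e f :|: arm (dual inc) r e n.
pose S := [set v : P + L | match v with inl p => p \in A | inr l => l \in B end].
have SA : points_of S = A by apply/setP=> p; rewrite !inE.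
have SB : lines_of S = B by apply/setP=> p; rewrite !inE.
have cA : #|A| <= 2 * q.-1.
  by apply: leq_trans (leq_card_setU _ _) _; rewrite !(card_arm R) //; lia.
have cB : #|B| <= 2 * q.-1.
  by apply: leq_trans (leq_card_setU _ _) _; rewrite !(card_arm D) //; lia.
exists S; last by rewrite card_points_lines SA SB; lia.
apply: (separates_resolving R); rewrite ?SA ?SB.
- rewrite card_points_lines SA.
  have /subset_leq_card : arm inc e O r \subset A by exact: subsetUl.
  by rewrite (card_arm R) //; lia.
- apply: (arms_separate R) => //; first by rewrite eq_sym.
  by move=> g Og ge gf; rewrite !inE gf ge /= /dual Og.
- apply: (arms_separate D) => //; first by rewrite eq_sym.
  by move=> g Og ge gf; rewrite !inE gf ge /=; move: Og; rewrite /dual => ->.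
Qed.

Lemma resolving_set_lower (P L : finType) (inc : P -> L -> bool) q (O : P)
    (S : {set P + L}) :
  regular_plane inc q -> 23 <= q -> resolving_set (incidence_graph inc) S ->
  4 * q - 4 <= #|S|.
Proof.
move=> R q23 /(resolving_separates R)[sL sP]; have D := regular_plane_dual R.
have [e _] := rp_join R O O.
rewrite leqNgt card_points_lines; apply/negP=> lt.
(* Of at most 4q - 5 elements, at most 2q - 3 are points or at most 2q - 3 are lines; the second
   case is the first in the dual plane. *)
have [A_le|A_gt] := leqP (#|points_of S| + 3) (2 * q).
  have [sk tg] := (separates_skew sL, separates_tangent sL).
  by apply: (no_small_resolving R sk tg q23 A_le _ e); lia.
have [sk tg] := (separates_skew sP, separates_tangent sP).
by apply: (no_small_resolving D sk tg q23 _ _ O); lia.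
Qed.

Theorem theorem1 (P L : finType) (inc : P -> L -> bool) (q : nat)
    (plane : projective_plane inc) (order_q : plane_order inc q)
    (q_ge23 : 23 <= q) :
  metric_dimension (incidence_graph inc) = 4 * q - 4.
Proof.
have R := regular_plane_of_order plane order_q.
have [Q [Q4 _]] := pp_quadrangle plane.
have /card_gt0P[O _] : 0 < #|Q| by rewrite Q4.
have [[S resS cS] minS] := metric_dimensionP (incidence_graph inc).
have q2 : 2 < q by apply: leq_trans q_ge23.
have [T resT cT] := small_resolving_set O R q2.
apply/eqP; rewrite eqn_leq (leq_trans (minS _ resT)) //= -cS.
exact: (resolving_set_lower O R q_ge23 resS).
Qed.
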